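(* Let $F_1,\ldots,F_s$ be pairwise nonisomorphic connected nontrivial vertex-transitive Cartesian-prime graphs. Let $m_i\ge1$ and $G=F_1^{\square m_1}\square\cdots\square F_s^{\square m_s}$. Choose roots $r_i\in V(F_i)$ and let $a$ be the vertex of $G$ whose coordinate is $r_i$ in every copy of $F_i$. Set $t_i=t(F_i,r_i)$. Then $$\dim U_a^-+1=\prod_{i=1}^s\binom{t_i+m_i-1}{m_i}.$$ More precisely, the distance-graded orbit profile $$\Omega_{G,a}(z)=\sum_{k\ge0}|\operatorname{Aut}(G)_a\backslash S_k(a)|\,z^k$$ satisfies $$\Omega_{G,a}(z)=\prod_{i=1}^s\left(\sum_{\substack{\alpha\in\mathbb Z_{\ge0}^{\mathcal O(F_i,r_i)}\\ \sum_O\alpha_O=m_i}}z^{\sum_O\alpha_O\rho(O)}\right).$$ The dimension $\dim U_a^-$ and the profile $\Omega_{G,a}$ do not depend on the choice of the root $a$ of $G$.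
   Context: All graphs are finite and simple; $\square$ is the Cartesian product and $F^{\square m}$ the $m$-fold Cartesian power. A graph is nontrivial if it has at least two vertices; a nontrivial graph is Cartesian-prime if it is not isomorphic to a Cartesian product of two nontrivial graphs. For a connected graph $F$ with root $r$, $\operatorname{Aut}(F)_r$ is the stabilizer of $r$ in the automorphism group, $\mathcal O(F,r)$ is the set of $\operatorname{Aut}(F)_r$-orbits on all vertices of $F$ (including the root orbit $\{r\}$), and $t(F,r)=|\mathcal O(F,r)|$. Every orbit $O\in\mathcal O(F,r)$ lies in one distance sphere around $r$; $\rho(O)$ denotes that distance. $S_k(a)$ is the set of vertices at distance $k$ from $a$, and $\operatorname{Aut}(G)_a\backslash S_k(a)$ is the set of $\operatorname{Aut}(G)_a$-orbits in it. $U_a^-=(\mathbb R^{V(G)\setminus\{a\}})^{\operatorname{Aut}(G)_a}$ is the real vector space of vectors on $V(G)\setminus\{a\}$ that are constant on $\operatorname{Aut}(G)_a$-orbits. *)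

(* Defs.v *)
From HB Require Import structures.
From mathcomp Require Import all_boot all_order all_fingroup all_algebra reals.

Set Implicit Arguments.
Unset Strict Implicit.
Unset Printing Implicit Defensive.

Import GRing.Theory.
Local Open Scope ring_scope.

Record graph := Graph {
  vertex :> finType;
  adj : rel vertex;
  adj_sym : symmetric adj;
  adj_irr : irreflexive adj
}.
Arguments adj {g} x y.

Definition isomorphic (A B : graph) : Prop :=
  exists2 f : A -> B, bijective f & forall x y, adj (f x) (f y) = adj x y.

Definition connected (F : graph) : Prop := forall x y : F, connect adj x y.

Definition nontrivial (F : graph) : Prop := (2 <= #|F|)%N.

Section Cartesian.

Section Binary.
Variables A B : graph.

Definition box_adj (x y : A * B) : bool :=
  ((x.1 == y.1) && adj x.2 y.2) || (adj x.1 y.1 && (x.2 == y.2)).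

Lemma box_sym : symmetric box_adj.
Proof.
move=> x y; rewrite /box_adj (eq_sym x.1) (eq_sym x.2).
by rewrite (adj_sym x.1) (adj_sym x.2).
Qed.

Lemma box_irr : irreflexive box_adj.
Proof. by move=> x; rewrite /box_adj !adj_irr andbF. Qed.

Definition box : graph := Graph box_sym box_irr.
End Binary.

Section Indexed.
Variables (I : finType) (F : I -> graph).

Definition bigbox_adj (x y : {dffun forall i, F i}) : bool :=
  [exists i, adj (x i) (y i) && [forall j, (j != i) ==> (x j == y j)]].

Lemma bigbox_sym : symmetric bigbox_adj.
Proof.
move=> x y; apply: eq_existsb => i; rewrite adj_sym; congr (_ && _).
by apply: eq_forallb => j; rewrite [x j == _]eq_sym.
Qed.

Lemma bigbox_irr : irreflexive bigbox_adj.
Proof. by move=> x; apply/existsP => -[i]; rewrite adj_irr. Qed.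

Definition bigbox : graph := Graph bigbox_sym bigbox_irr.
End Indexed.

Definition box_pow (F : graph) (m : nat) : graph := bigbox (fun _ : 'I_m => F).

Definition box_prod_pow (s : nat) (F : 'I_s -> graph) (m : 'I_s -> nat) : graph :=
  bigbox (fun i : 'I_s => box_pow (F i) (m i)).

Definition diag_root (s : nat) (F : 'I_s -> graph) (m : 'I_s -> nat)
    (r : forall i, F i) : box_prod_pow F m :=
  @finfun _ (fun i => {ffun 'I_(m i) -> F i}) (fun i => [ffun _ => r i]).

End Cartesian.

Definition cartesian_prime (F : graph) : Prop :=
  nontrivial F /\
  forall A B : graph, nontrivial A -> nontrivial B -> ~ isomorphic F (box A B).

Section Automorphisms.
Variable F : graph.

Definition aut : {set {perm F}} :=
  [set p : {perm F} | [forall x, forall y, adj (p x) (p y) == adj x y]].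

Lemma autP (p : {perm F}) :
  reflect (forall x y, adj (p x) (p y) = adj x y) (p \in aut).
Proof.
rewrite inE; apply: (iffP forallP) => [h x y|h x].
  by have /forallP/(_ y)/eqP := h x.
by apply/forallP => y; rewrite h.
Qed.

Lemma aut_group_set : group_set aut.
Proof.
apply/group_setP; split=> [|p q /autP hp /autP hq]; apply/autP => x y.
  by rewrite !perm1.
by rewrite !permM hq hp.
Qed.
Canonical aut_group := Group aut_group_set.

Definition vertex_transitive : Prop := [transitive aut, on [set: F] | 'P].

Definition root_orbit (r x : F) : {set F} := orbit 'P 'C_aut[r | 'P]%g x.

Definition root_orbits (r : F) : {set {set F}} := [set root_orbit r x | x : F].

Definition root_orbit_type (r : F) : finType := {O : {set F} | O \in root_orbits r}.

End Automorphisms.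

Section Distance.
Variable F : graph.

Definition walk (n : nat) (x y : F) : bool :=
  [exists p : n.-tuple F, path adj x p && (last x p == y)].

(* Length of a shortest walk; #|F| by convention if there is none. *)
Definition dist (x y : F) : nat := find (fun n => walk n x y) (iota 0 #|F|).

Definition sphere (k : nat) (a : F) : {set F} := [set x | dist a x == k].

(* The distance from r to the orbit O, read off at one vertex of O; by
   [orbit_distE] the choice is irrelevant. *)
Definition orbit_dist (r : F) (O : {set F}) : nat :=
  if [pick x in O] is Some x then dist r x else 0%N.

Lemma connect_walk (x y : F) :
  connect adj x y -> exists2 n, (n < #|F|)%N & walk n x y.
Proof.
case/connectP => p0 xp0 ->; case/shortenP: xp0 => p xp up _.
exists (size p); last by apply/existsP; exists (in_tuple p); rewrite xp eqxx.
by have := max_card [in x :: p]; rewrite (card_uniqP up).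
Qed.

Lemma dist_lt_card (x y : F) : connect adj x y -> (dist x y < #|F|)%N.
Proof.
case/connect_walk => n ltn w; rewrite -[ltnRHS](size_iota 0) -has_find.
by apply/hasP; exists n; rewrite ?mem_iota.
Qed.

Lemma dist_walk (x y : F) : connect adj x y -> walk (dist x y) x y.
Proof.
move=> cxy; have ltd := dist_lt_card cxy.
have := @nth_find _ 0%N (fun n => walk n x y) (iota 0 #|F|).
by rewrite has_find size_iota nth_iota // add0n; apply.
Qed.

Lemma dist_min (x y : F) n : walk n x y -> (dist x y <= n)%N.
Proof.
move=> w; rewrite leqNgt; apply/negP => ltn.
have ltF : (n < #|F|)%N.
  by apply: leq_trans ltn _; rewrite -[leqRHS](size_iota 0) find_size.
by have := before_find 0%N ltn; rewrite nth_iota // add0n w.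
Qed.

Lemma walk_aut n (p : {perm F}) (x y : F) :
  p \in aut F -> walk n (p x) (p y) = walk n x y.
Proof.
have imp (q : {perm F}) u v : q \in aut F -> walk n u v -> walk n (q u) (q v).
  move=> /autP hq /existsP[t /andP[ut /eqP lt]].
  apply/existsP; exists [tuple of map q t]; rewrite last_map lt eqxx andbT.
  by rewrite path_map (eq_path (e' := adj)) // => ? ?; rewrite /= hq.
move=> ap; apply/idP/idP; last exact: imp.
by move/(imp p^-1%g); rewrite !permK groupV; apply.
Qed.

Lemma orbit_distE (r x : F) (O : {set F}) :
  O \in root_orbits r -> x \in O -> orbit_dist r O = dist r x.
Proof.
case/imsetP => y _ ->; rewrite /orbit_dist; case: pickP => [z|/(_ x) ->] //.
have aux w : w \in root_orbit r y -> dist r w = dist r y.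
  case/orbitP => p /setIP[ap /astab1P rp] <-; apply: eq_find => n /=.
  by rewrite -{1}rp; apply: walk_aut.
by move=> /aux -> /aux ->.
Qed.

(* In a connected graph the spheres of radius at least #|F| are empty, so the
   truncation loses nothing; see [coef_orbit_profile]. *)
Definition orbit_profile (a : F) : {poly int} :=
  \poly_(k < #|F|) #|[set root_orbit a x | x in sphere k a]|%:R.

Lemma coef_orbit_profile (a : F) (k : nat) : connected F ->
  (orbit_profile a)`_k = #|[set root_orbit a x | x in sphere k a]|%:R.
Proof.
move=> cF; rewrite coef_poly; case: ltnP => // leFk.
rewrite (_ : sphere k a = set0) ?imset0 ?cards0 //; apply/setP => x.
by rewrite !inE ltn_eqF // (leq_trans (dist_lt_card (cF a x))).
Qed.

End Distance.

Section InvariantVectors.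
Variables (R : realType) (F : graph) (a : F).

Definition punctured : finType := {x : F | x != a}.

Definition coord_diff (p : punctured * punctured) (u : {ffun punctured -> R^o}) : R^o :=
  u p.1 - u p.2.

Lemma coord_diff_linear p : linear (coord_diff p).
Proof.
by move=> c u v; rewrite /coord_diff !ffunE scalerBr opprD addrACA.
Qed.

HB.instance Definition _ p :=
  GRing.isLinear.Build R {ffun punctured -> R^o} R^o *:%R (coord_diff p)
    (coord_diff_linear p).

Definition invariant_space : {vspace {ffun punctured -> R^o}} :=
  (\bigcap_(p : punctured * punctured | val p.2 \in root_orbit a (val p.1))
     lker (linfun (coord_diff p)))%VS.

Lemma invariant_spaceP (u : {ffun punctured -> R^o}) :
  reflect (forall x y : punctured, val y \in root_orbit a (val x) -> u x = u y)
          (u \in invariant_space).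
Proof.
rewrite memvE; apply: (iffP subv_bigcapP) => [h x y yx|h p pp].
  have := h (x, y) yx; rewrite -memvE memv_ker lfunE /= subr_eq0.
  by move/eqP.
by rewrite -memvE memv_ker lfunE /= subr_eq0; apply/eqP/h.
Qed.

End InvariantVectors.

(* Main.v *)
From HB Require Import structures.
Require Import Defs.
From mathcomp Require Import all_boot all_order all_fingroup all_algebra reals.
(* Here [aut] means graph automorphisms, not the extension of a group morphism. *)
Import Defs.

(** Everything follows from a description of the automorphisms of a Cartesian
    product of connected prime graphs: they permute the coordinates and act on
    each of them by an isomorphism of factors ([aut_product]).  The reason is
    metric.  Distance in a product is the sum of the coordinate distances
    ([dist_coord]), so layers are convex ([between_layer]), and a convex set
    contains every mixture of coordinates of its points ([between_mix]), that
    is, it is a box.  An automorphism preserves distance, so it maps a layer to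
    a convex copy of a prime factor; such a box has a single nontrivial side
    ([prime_embedding]), and applying this to the inverse as well shows that
    layers through [a] go onto layers through the image of [a].  Finally, the
    projection of a vertex to a layer is its closest point there, so
    automorphisms also commute with projections, which forces each coordinate
    of the image to depend on one coordinate of the argument.

    As factors with different indices are not isomorphic, the permutation only
    exchanges copies of the same factor.  When the root is fixed, each isomorphism
    between copies fixes the root of the factor, hence preserves the root orbits
    of that factor.  Thus two vertices of [G] lie in the same root orbit exactly
    when, for each [i] and each root orbit [O] of [F i], they have the same number
    of entries in [O] ([root_orbit_entry_counts]); conversely equal counts provide
    permutations of the copies and root-fixing automorphisms of the factors that
    match the two vertices.  Every family of counts with totals [m i] occurs
    ([entry_counts_image]), and the distance to the root is the sum of the orbit
    distances weighted by the counts ([dist_entry_counts]).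

    The profile is the sum of ['X^(orbit_dist a O)] over the root orbits
    ([orbit_profileE]); re-indexed by counts, it is the expansion of the stated
    product ([orbit_profile_product]).  Its value at 1 counts the root orbits,
    with a binomial coefficient for each factor ([card_ffun_sum]), and the
    invariant vectors off the root are the functions on the root orbits other
    than the root itself ([dim_invariant_space]).  Independence of the root holds
    because a product of vertex-transitive graphs is vertex-transitive. *)

Set Implicit Arguments.
Unset Strict Implicit.
Unset Printing Implicit Defensive.

Import GRing.Theory.
Local Open Scope nat_scope.

(** * Graph distance *)

Section Distance.
Variable F : graph.
Implicit Types x y z : F.

Lemma walkP n x y :
  reflect (exists p, [/\ size p = n, path adj x p & last x p = y]) (walk n x y).
Proof.
apply: (iffP existsP) => [[p /andP[xp /eqP <-]]|[p [sp xp lp]]].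
  by exists p; rewrite size_tuple.
have sp' : size p == n by apply/eqP.
by exists (Tuple sp'); rewrite /= xp lp eqxx.
Qed.

Lemma walk0 x y : walk 0 x y = (x == y).
Proof.
apply/walkP/eqP => [[p [/size0nil -> _ //]]|->].
by exists [::].
Qed.

Lemma walkS n x y : reflect (exists2 z, walk n x z & adj z y) (walk n.+1 x y).
Proof.
apply: (iffP (walkP _ _ _)) => [[p []]|[z /walkP[p [sp xp lp]] zy]].
  case/lastP: p => [//|p z]; rewrite size_rcons rcons_path last_rcons.
  move=> [sp] /andP[xp zp] <-; exists (last x p) => //.
  by apply/walkP; exists p.
exists (rcons p y); rewrite size_rcons rcons_path last_rcons sp xp lp.
by split.
Qed.

Lemma walk_cat n1 n2 x y z : walk n1 x y -> walk n2 y z -> walk (n1 + n2) x z.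
Proof.
case/walkP=> p [<- xp yp] /walkP[q [<- yq <-]]; apply/walkP; exists (p ++ q).
by rewrite size_cat cat_path last_cat xp yp.
Qed.

Lemma walk_connect n x y : walk n x y -> connect adj x y.
Proof. by case/walkP=> p [_ xp <-]; apply/connectP; exists p. Qed.

Lemma dist_aut (p : {perm F}) x y : p \in aut F -> dist (p x) (p y) = dist x y.
Proof. by move=> ap; apply: eq_find => n; apply: walk_aut. Qed.

Lemma distxx x : dist x x = 0.
Proof. by apply/eqP; rewrite -leqn0 dist_min // walk0. Qed.

(** A function that grows by at most one along edges is a lower bound for the
    distance, and descending along it yields a walk of its length.  Distance
    formulas can thus be checked edge by edge. *)
Lemma dist_unique (x : F) (f : F -> nat) :
    f x = 0 -> (forall y z, adj y z -> f z <= (f y).+1) ->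
    (forall y, f y = 0 -> y = x) ->
    (forall y, 0 < f y -> exists2 z, adj z y & f y = (f z).+1) ->
  forall y, connect adj x y /\ dist x y = f y.
Proof.
move=> f0 lip sep desc y.
have w : walk (f y) x y.
  move en: (f y) => n; elim: n y en => [|n IHn] y fy.
    by rewrite walk0 (sep _ fy).
  case: (desc y); rewrite fy // => z zy [fz]; apply/walkS.
  by exists z; rewrite ?IHn.
have lb n z : walk n x z -> f z <= n.
  elim: n z => [|n IHn] z; first by rewrite walk0 => /eqP <-; rewrite f0.
  by case/walkS => u /IHn fu /lip; move/leq_trans; apply.
have c := walk_connect w; split=> //; apply/eqP.
by rewrite eqn_leq dist_min // lb // dist_walk.
Qed.

Section Connected.
Hypothesis F_conn : connected F.

Lemma dist_eq0 x y : (dist x y == 0) = (x == y).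
Proof.
apply/eqP/eqP => [d0|->]; last exact: distxx.
by apply/eqP; rewrite -walk0 -d0 dist_walk.
Qed.

Lemma dist_triangle x y z : dist x z <= dist x y + dist y z.
Proof. by apply/dist_min/walk_cat; apply: dist_walk. Qed.

Lemma dist_adjr x y z : adj y z -> dist x z <= (dist x y).+1.
Proof.
by move=> yz; apply/dist_min/walkS; exists y => //; apply: dist_walk.
Qed.

Lemma dist_predr x y :
  0 < dist x y -> exists2 z, adj z y & dist x y = (dist x z).+1.
Proof.
have := dist_walk (F_conn x y); case ed: (dist x y) => [//|d].
case/walkS => z w zy _; exists z => //; apply/eqP.
by rewrite eqSS eqn_leq (dist_min w) andbT -ltnS -ed dist_adjr.
Qed.

End Connected.
End Distance.

(** * Cartesian products through coordinates *)

(** [G] presented as the Cartesian product of the graphs [H j] through its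
    coordinate functions.  Working with coordinates lets iterated products such
    as [box_prod_pow] be treated as products over one flat index set. *)
Record product_coordinates (J : finType) (H : J -> graph) (G : graph) :=
  ProductCoordinates {
  coord :> G -> forall j, H j;
  point : (forall j, H j) -> G;
  pointK : forall f j, coord (point f) j = f j;
  coord_inj : forall x y, (forall j, coord x j = coord y j) -> x = y;
  adj_coordP : forall x y : G,
    reflect (exists2 j, adj (coord x j) (coord y j) &
               forall k, k != j -> coord x k = coord y k) (adj x y)
}.

Section Coordinates.
Variables (J : finType) (H : J -> graph) (G : graph).
Variable c : product_coordinates H G.
Implicit Types (x y z a : G) (j k : J).

(** [x] with its coordinate [j] replaced; the vertices [upd a u] for [u : H j]
    form the [j]-layer through [a]. *)
Definition upd x j (u : H j) : G := point c (dfwith (c x) u).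

Lemma upd_in x j (u : H j) : c (upd x u) j = u.
Proof. by rewrite pointK dfwith_in. Qed.

Lemma upd_out x j (u : H j) k : k != j -> c (upd x u) k = c x k.
Proof. by move=> kj; rewrite pointK dfwith_out // eq_sym. Qed.

Lemma upd_eq x y j : (forall k, k != j -> c y k = c x k) -> y = upd x (c y j).
Proof.
move=> yx; apply: (coord_inj (p := c)) => k; have [->|kj] := eqVneq k j.
  by rewrite upd_in.
by rewrite upd_out // yx.
Qed.

Lemma adj_layer x y j :
  (forall k, k != j -> c x k = c y k) -> adj x y = adj (c x j) (c y j).
Proof.
move=> xy; apply/(adj_coordP c)/idP => [[k xyk eqk]|]; last by exists j.
have [<- //|kj] := eqVneq k j.
by rewrite xy // adj_irr in xyk.
Qed.

Hypothesis H_conn : forall j, connected (H j).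

(** Walks in a product move one coordinate at a time, so their lengths add up. *)
Lemma connect_dist_coord x y :
  connect adj x y /\ dist x y = \sum_j dist (c x j) (c y j).
Proof.
move: y; apply: dist_unique => [|y z /(adj_coordP c)[j yz eqk]|y /eqP|y].
- by rewrite big1 // => j _; rewrite distxx.
- rewrite (bigD1 j) //= [X in _ <= X.+1](bigD1 j) //= -addSn leq_add ?dist_adjr //.
  by apply/eq_leq/eq_bigr => k kj; rewrite eqk.
- rewrite sum_nat_eq0 => /forallP d0; apply: (coord_inj (p := c)) => j.
  by apply/esym/eqP; rewrite -dist_eq0 // -[_ == 0](implyTb) d0.
rewrite lt0n sum_nat_eq0 => /forallPn[j].
rewrite /= -lt0n => /dist_predr[//|u uy du].
exists (upd y u).
  by rewrite (@adj_layer _ _ j) ?upd_in // => k kj; rewrite upd_out.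
rewrite (bigD1 j) //= [in RHS](bigD1 j) //= upd_in du addSn; congr (_ + _).+1.
by apply: eq_bigr => k kj; rewrite upd_out.
Qed.

Lemma dist_coord x y : dist x y = \sum_j dist (c x j) (c y j).
Proof. by case: (connect_dist_coord x y). Qed.

Lemma coord_connected : connected G.
Proof. by move=> x y; case: (connect_dist_coord x y). Qed.

Lemma dist_upd x a j (w : H j) :
  dist x (upd a w) = dist (c x j) w + \sum_(k | k != j) dist (c x k) (c a k).
Proof.
rewrite dist_coord (bigD1 j) //= upd_in; congr addn.
by apply: eq_bigr => k kj; rewrite upd_out.
Qed.

(** Membership of [z] in the metric interval from [x] to [y]. *)
Definition between x z y := dist x z + dist z y = dist x y.

Lemma between_mix x y z :
  (forall j, c z j = c x j \/ c z j = c y j) -> between x z y.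
Proof.
move=> mix; rewrite /between !dist_coord -big_split; apply: eq_bigr => j _ /=.
by case: (mix j) => ->; rewrite distxx ?addn0.
Qed.

(** Layers are convex, because the coordinates that [x] and [y] share
    contribute nothing to the distance. *)
Lemma between_layer x y z j :
    (forall k, k != j -> c x k = c y k) -> between x z y ->
  forall k, k != j -> c z k = c x k.
Proof.
move=> xy; rewrite /between !dist_coord -big_split (bigD1 j) //= [RHS](bigD1 j) //=.
rewrite [X in _ = _ + X]big1 => [|k kj]; last by rewrite xy // distxx.
have := dist_triangle (@H_conn j) (c x j) (c z j) (c y j).
rewrite -(leq_add2r
  (\sum_(k | k != j) (dist (c x k) (c z k) + dist (c z k) (c y k)))).
move=> /[swap] ->; rewrite leq_add2l leqn0 sum_nat_eq0 => /forallP d0 k kj.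
have /implyP/(_ kj) := d0 k; rewrite addn_eq0 dist_eq0 // => /andP[/eqP ->] //.
Qed.

(** A prime graph embedded as a convex subgraph varies in one coordinate only:
    a convex set contains all mixtures of its points, so it is the product of
    its projection to coordinate [j] and its projection to the other
    coordinates. *)
Lemma prime_embedding (P : graph) (f : P -> G) :
    cartesian_prime P -> injective f ->
    (forall u v, adj (f u) (f v) = adj u v) ->
    (forall u v z, between (f u) z (f v) -> exists w, f w = z) ->
  exists j, forall u v k, k != j -> c (f u) k = c (f v) k.
Proof.
case=> P_nt P_prime f_inj f_adj f_conv.
have [o [o' oo']] : exists o o' : P, o != o'.
  have /card_gt1P[o [o' [_ _ oo']]] : 1 < #|P| by [].
  by exists o, o'.
have [j foo'] : exists j, c (f o) j != c (f o') j.
  apply/existsP; apply: contraNT oo'; rewrite negb_exists => /forallP eqo.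
  by apply/eqP/f_inj/(coord_inj (p := c)) => j; apply/eqP/negPn/eqo.
exists j => u1 u2 k1 k1j; apply/eqP/negPn/negP => fu12.
(* Convexity makes the image of [f] closed under mixing the coordinate [j] of
   one point with the other coordinates of another. *)
have mxP u v : {w | f w = upd (f v) (c (f u) j)}.
  apply: sig_eqW; apply: (f_conv u v); apply: between_mix => k.
  have [->|kj] := eqVneq k j; first by left; rewrite upd_in.
  by right; rewrite upd_out.
pose mx u v := sval (mxP u v).
have mxj u v : c (f (mx u v)) j = c (f u) j.
  by rewrite /mx (svalP (mxP u v)) upd_in.
have mxk u v k : k != j -> c (f (mx u v)) k = c (f v) k.
  by move=> kj; rewrite /mx (svalP (mxP u v)) upd_out.
have f_ext u v : c (f u) j = c (f v) j ->
    (forall k, k != j -> c (f u) k = c (f v) k) -> u = v.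
  move=> ej ek; apply/f_inj/(coord_inj (p := c)) => k.
  by have [->|/ek] := eqVneq k j.
(* [P] is the product of the subgraphs induced on its layers through [o]. *)
pose sub (p : pred P) := @Graph {u : P | p u} (relpre val (@adj P))
  (fun u v => adj_sym (val u) (val v)) (fun u => adj_irr (val u)).
pose A := sub (fun u => mx u o == u); pose B := sub (fun u => mx o u == u).
have Ain u : mx (mx u o) o == mx u o.
  by apply/eqP/f_ext => [|k kj]; rewrite ?mxj // !mxk.
have Bin u : mx o (mx o u) == mx o u.
  by apply/eqP/f_ext => [|k kj]; rewrite ?mxj // !mxk.
pose toA u : A := exist _ (mx u o) (Ain u).
pose toB u : B := exist _ (mx o u) (Bin u).
apply: (P_prime A B).
- apply/card_gt1P; exists (toA o), (toA o'); split=> //.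
  apply: contra foo' => /eqP e; have /= {}e := congr1 val e.
  by rewrite -(mxj o o) e mxj.
- apply/card_gt1P; exists (toB u1), (toB u2); split=> //.
  apply/negP => /eqP e; have /= {}e := congr1 val e; case/eqP: fu12.
  by rewrite -(mxk o u1) // e mxk.
pose mix (ab : box A B) := mx (val ab.1) (val ab.2).
exists (fun u => (toA u, toB u)).
  exists mix => [x|[[a aP] [b bP]]].
    by apply: f_ext => [|k kj]; rewrite ?mxj // !mxk.
  congr pair; apply: val_inj; rewrite /= /mix /=.
    rewrite -[RHS](eqP aP); apply: f_ext => [|k kj]; rewrite ?mxj // !mxk //.
  by rewrite -[RHS](eqP bP); apply: f_ext => [|k kj]; rewrite ?mxj // !mxk.
move=> x y; rewrite /= /box_adj /= -[RHS]f_adj.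
have eqA : (toA x == toA y) = (c (f x) j == c (f y) j).
  apply/eqP/eqP => [e|e].
    by have /= {}e := congr1 val e; rewrite -(mxj x o) e mxj.
  by apply: val_inj; apply: f_ext => [|k kj]; rewrite ?mxj // !mxk.
have eqB : toB x = toB y <-> forall k, k != j -> c (f x) k = c (f y) k.
  split=> [e k kj|e].
    by have /= {}e := congr1 val e; rewrite -(mxk o x) // e mxk.
  by apply: val_inj; apply: f_ext => [|k kj]; rewrite ?mxj // !mxk // e.
have adjA : adj (mx x o) (mx y o) = adj (c (f x) j) (c (f y) j).
  by rewrite -f_adj (@adj_layer _ _ j) ?mxj // => k kj; rewrite !mxk.
rewrite eqA adjA -f_adj; apply/orP/idP.
  case=> [/andP[/eqP ej]|/andP[ad /eqP/eqB ek]]; last first.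
    by apply/(adj_coordP c); exists j.
  case/(adj_coordP c)=> k; have [->|kj] := eqVneq k j.
    by rewrite !mxj adj_irr.
  rewrite !mxk // => ad ek; apply/(adj_coordP c); exists k => // l lk.
  have [-> //|lj] := eqVneq l j.
  by have := ek _ lk; rewrite !mxk.
case/(adj_coordP c) => k; have [->|kj] := eqVneq k j => ad ek.
  by right; rewrite ad; apply/eqP/eqB.
left; rewrite ek ?eqxx /= 1?eq_sym //; apply/(adj_coordP c); exists k.
  by rewrite !mxk.
move=> l lk; have [->|lj] := eqVneq l j; first by rewrite !mxj.
by rewrite !mxk // ek.
Qed.

(** * Automorphisms of products of prime graphs *)

Hypothesis H_prime : forall j, cartesian_prime (H j).

(** Automorphisms preserve intervals, so they map layers to convex copies of a
    prime graph. *)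
Lemma aut_layer (p : {perm G}) a j : p \in aut G ->
  exists j', forall (u : H j) k, k != j' -> c (p (upd a u)) k = c (p a) k.
Proof.
move=> ap; have /autP padj := ap.
have updC (u v : H j) k : k != j -> c (upd a u) k = c (upd a v) k.
  by move=> kj; rewrite !upd_out.
have [|||j' pj'] := @prime_embedding (H j) (fun u => p (upd a u)) (H_prime j).
- by move=> u v /perm_inj e; rewrite -(upd_in a u) e upd_in.
- move=> u v; rewrite padj (@adj_layer _ _ j) ?upd_in //; exact: updC.
- move=> u v z; rewrite /between -[z](permKV p) !dist_aut // => bz.
  have zk := between_layer (updC u v) bz.
  exists (c (p^-1%g z) j); congr (p _).
  by symmetry; apply: upd_eq => k kj; rewrite zk // upd_out.
exists j' => u k kj; rewrite (pj' u (c a j)) //; congr (c (p _) k).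
by symmetry; apply: upd_eq.
Qed.

(** An automorphism [p] maps each layer through [a] onto a layer through [p a].
    It maps the vertex of a layer closest to [x] to the vertex of the image
    layer closest to [p x]; since these closest vertices are the projections,
    each coordinate of [p x] is a function of one coordinate of [x]. *)
Theorem aut_product (p : {perm G}) a : p \in aut G ->
  exists s : {perm J}, forall j, exists f : H j -> H (s j),
    [/\ bijective f, forall u v, adj (f u) (f v) = adj u v &
        forall x, c (p x) (s j) = f (c x j)].
Proof.
move=> ap; have aVp : p^-1%g \in aut G by rewrite groupV.
have /autP padj := ap.
have [s0 s0P] := fin_all_exists (fun j => aut_layer a j ap).
have [t tP] := fin_all_exists (fun j => aut_layer (p a) j aVp).
(* The layer [s0 j] contains the image of a vertex [upd a u] off [a], which the
   inverse takes back to the layer [j]. *)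
have ts0 j : t (s0 j) = j.
  have [u uj] : exists u : H j, u != c a j.
    have /card_gt1P[u [v [_ _ uv]]] := proj1 (H_prime j).
    by have [eu|] := eqVneq u (c a j); [exists v; rewrite -eu eq_sym | exists u].
  apply/eqP; apply: contraNT uj; rewrite eq_sym => jt.
  have := tP (s0 j) (c (p (upd a u)) (s0 j)) j jt.
  by rewrite -upd_eq; [rewrite !permK upd_in => -> | exact: s0P].
have s0_inj : injective s0 by exact: can_inj ts0.
exists (perm s0_inj) => j; rewrite permE.
pose f (u : H j) := c (p (upd a u)) (s0 j).
pose g (v : H (s0 j)) := c (p^-1%g (upd (p a) v)) j.
have p_upd u : p (upd a u) = upd (p a) (f u) by apply: upd_eq => k kj; apply: s0P.
have p_updV v : upd (p a) v = p (upd a (g v)).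
  rewrite -(upd_eq (y := p^-1%g (upd (p a) v))) ?permKV // => k kj.
  by have := tP (s0 j) v k; rewrite ts0 permK; apply.
exists f; split=> [|u v|x].
- exists g => [u|v]; first by rewrite /g -p_upd permK upd_in.
  by rewrite /f -p_updV upd_in.
- rewrite -(@adj_layer (p (upd a u)) (p (upd a v)) (s0 j)) => [|k kj]; last first.
    by rewrite !s0P.
  by rewrite padj (@adj_layer _ _ j) ?upd_in // => k kj; rewrite !upd_out.
(* [p] maps the [j]-layer through [a] onto the [s0 j]-layer through [p a].
   Compare the distance from [x] to its projection [upd a (c x j)] with its
   distance to the vertex that [p] maps to the projection of [p x]: as the
   projection is the closest vertex, the two vertices coincide. *)
have d1 := dist_aut x (upd a (c x j)) ap.
have := dist_aut x (upd a (g (c (p x) (s0 j)))) ap.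
rewrite -p_updV dist_upd distxx add0n dist_upd => d2; move: d1.
rewrite p_upd !dist_upd distxx d2 addnA => /eqP.
by rewrite eqn_add2r addn_eq0 dist_eq0 // => /andP[/eqP].
Qed.

End Coordinates.

(** * Root orbits *)

Section RootOrbits.
Variable F : graph.
Implicit Types (r x y : F) (p : {perm F}).

Lemma root_orbitP r x y :
  reflect (exists p, [/\ p \in aut F, p r = r & p x = y]) (y \in root_orbit r x).
Proof.
apply: (iffP orbitP) => [[p]|[p [ap pr px]]].
  by rewrite inE => /andP[ap /astab1P pr] <-; exists p.
by exists p => //; rewrite inE ap; apply/astab1P.
Qed.

Lemma root_orbit_refl r x : x \in root_orbit r x.
Proof. exact: orbit_refl. Qed.

Lemma root_orbit_eq r x y :
  (root_orbit r x == root_orbit r y) = (y \in root_orbit r x).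
Proof.
rewrite eq_sym; apply/eqP/idP => [<-|/orbit_eqP //]; exact: root_orbit_refl.
Qed.

Lemma root_orbit_aut p r x :
  p \in aut F -> root_orbit (p r) (p x) = p @: root_orbit r x.
Proof.
have sub q s y : q \in aut F -> q @: root_orbit s y \subset root_orbit (q s) (q y).
  move=> aq; apply/subsetP => _ /imsetP[z /root_orbitP[h [ah hs hy]] ->].
  apply/root_orbitP; exists (q^-1 * h * q)%g.
  by rewrite !groupM ?groupV // !permM !permK hs hy.
move=> ap; apply/eqP; rewrite eqEsubset sub // andbT.
have apV : p^-1%g \in aut F by rewrite groupV.
have := imsetS p (sub _ (p r) (p x) apV); rewrite !permK -imset_comp.
by rewrite (eq_imset (g := id)) ?imset_id // => z; rewrite /= permKV.
Qed.

Lemma root_orbit_dist r x : orbit_dist r (root_orbit r x) = dist r x.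
Proof. by apply: orbit_distE (root_orbit_refl r x); apply: imset_f. Qed.

(** Conjugation by [p] carries the stabilizer of [r] to that of [p r]. *)
Lemma orbits_aut p r (S : {set F}) : p \in aut F ->
  #|[set root_orbit (p r) x | x in p @: S]| = #|[set root_orbit r x | x in S]|.
Proof.
move=> ap; rewrite -imset_comp.
rewrite (eq_imset (g := (fun O : {set F} => p @: O) \o root_orbit r)) => [|x /=].
  by rewrite imset_comp card_imset //; apply/imset_inj/perm_inj.
exact: root_orbit_aut.
Qed.

Lemma card_root_orbits_aut p r : p \in aut F ->
  #|root_orbits (p r)| = #|root_orbits r|.
Proof.
move=> ap.
have E q : root_orbits q = [set root_orbit q x | x in [set: F]].
  by apply/setP => O; apply/imsetP/imsetP => -[x _ ->]; exists x.
rewrite !E -(orbits_aut r _ ap) (_ : p @: setT = setT) //.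
by apply/setP => x; rewrite -[x](permKV p) imset_f ?inE.
Qed.

Lemma orbit_profile_aut p r : p \in aut F -> orbit_profile (p r) = orbit_profile r.
Proof.
move=> ap; apply: eq_poly => k _; rewrite -(orbits_aut r (sphere k r) ap).
rewrite (_ : p @: sphere k r = sphere k (p r)) //; apply/setP => x.
by rewrite -[x](permKV p) mem_imset ?inE ?dist_aut //; apply: perm_inj.
Qed.

End RootOrbits.

(** * Orbit counts in a power of one factor *)

Section OrbitCount.
Variables (F : graph) (r : F) (m : nat).
Implicit Types u v : 'I_m -> F.

Definition orbit_of (x : F) : root_orbit_type r :=
  exist _ (root_orbit r x) (imset_f (root_orbit r) (isT : x \in F)).

Lemma orbit_ofP x y :
  reflect (exists p, [/\ p \in aut F, p r = r & p x = y]) (orbit_of x == orbit_of y).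
Proof. by rewrite -val_eqE /= root_orbit_eq; apply: root_orbitP. Qed.

Lemma orbit_of_surj O : exists x, orbit_of x = O.
Proof. by case: O => O /[dup] /imsetP[x _ ->] ?; exists x; apply: val_inj. Qed.

(** The exponent vector of [u]; the bound [m] on each count makes the possible
    values a finite type. *)
Definition orbit_count u : {ffun root_orbit_type r -> 'I_m.+1} :=
  [ffun O => inord #|[set k | orbit_of (u k) == O]|].

Lemma orbit_countE u O : orbit_count u O = #|[set k | orbit_of (u k) == O]| :> nat.
Proof. by rewrite ffunE inordK // ltnS -[X in _ <= X]card_ord max_card. Qed.

Lemma sum_orbit_count u (w : root_orbit_type r -> nat) :
  \sum_O orbit_count u O * w O = \sum_k w (orbit_of (u k)).
Proof.
rewrite (partition_big (fun k => orbit_of (u k)) xpredT) //=.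
apply: eq_bigr => O _; rewrite (eq_bigr (fun _ => w O)) => [|k /eqP -> //].
by rewrite sum_nat_const orbit_countE cardsE.
Qed.

Lemma orbit_count_total u : \sum_O orbit_count u O = m.
Proof.
have := sum_orbit_count u (fun _ => 1); rewrite sum1_card card_ord.
by under eq_bigr do rewrite muln1.
Qed.

(** Lists with the same multiplicities are permutations of each other. *)
Lemma orbit_count_perm u v : orbit_count u = orbit_count v ->
  exists s : 'S_m, forall k, orbit_of (v k) = orbit_of (u (s k)).
Proof.
move=> euv; pose tu := [tuple orbit_of (u k) | k < m].
pose tv := [tuple orbit_of (v k) | k < m].
have countE w O : count_mem O [tuple orbit_of (w k) | k < m] = orbit_count w O.
  by rewrite orbit_countE cardsE cardE /enum_mem size_filter -enumT count_map.
have /tuple_permP[s es] : perm_eq tv tu.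
  apply/allP => O _ /=; rewrite /tu /tv; apply/eqP.
  by rewrite !countE euv.
exists s => k; have := congr1 (fun t => tnth t k) (val_inj es).
by rewrite !tnth_mktuple.
Qed.

Lemma orbit_count_surj (al : {ffun root_orbit_type r -> 'I_m.+1}) :
  \sum_O al O = m -> exists u, orbit_count u = al.
Proof.
move=> sal; pose s := flatten [seq nseq (al Q) Q | Q <- enum (root_orbit_type r)].
have sz : size s = m.
  rewrite size_flatten /shape -map_comp sumnE big_map big_enum /= -[RHS]sal.
  by apply: eq_bigr => O _; rewrite size_nseq.
have [f fP] := fin_all_exists orbit_of_surj.
exists (fun k => f (nth (orbit_of r) s k)); apply/ffunP => O; apply: ord_inj.
rewrite orbit_countE -sum1dep_card.
under eq_bigl => k do rewrite fP.
rewrite -(big_mkord (fun k => nth (orbit_of r) s k == O) (fun _ => 1)).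
rewrite -[X in index_iota 0 X]sz.
rewrite -(big_nth (orbit_of r) (pred1 O) (fun _ => 1)) sum1_count.
rewrite count_flatten -map_comp sumnE big_map big_enum /= (bigD1 O) //=.
rewrite count_nseq /= eqxx mul1n big1 ?addn0 // => O' /negbTE nO.
by rewrite count_nseq /= nO.
Qed.

End OrbitCount.

(** * Generating functions *)

Section DistributeDependent.
Local Open Scope ring_scope.

Lemma bigA_distr_fprod (R : comNzRingType) (I : finType) (T : I -> finType)
    (f : forall i, T i -> R) :
  \prod_i \sum_(x : T i) f i x = \sum_(t : fprod T) \prod_i f i (t i).
Proof.
pose g i : {ffun T i -> R} := [ffun x => f i x].
transitivity (\prod_i \sum_(x : T i) g i x).
  by apply: eq_bigr => i _; apply: eq_bigr => x _; rewrite ffunE.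
under eq_bigr do rewrite (big_tag g).
rewrite bigA_distr_big_dep -big_fprod.
by apply: eq_bigr => t _; apply: eq_bigr => i _; rewrite ffunE.
Qed.

(** Two maps with the same fibres share a transversal of the fibres, through
    which their images correspond.  This re-indexes sums over orbits by any
    complete invariant of the orbits. *)
Lemma big_imset_kernel (R : Type) (idx : R) (op : Monoid.com_law idx)
    (T U V : finType) (f : T -> U) (g : T -> V) (h : U -> R) (h' : V -> R) :
    (forall x y, (f x == f y) = (g x == g y)) -> (forall x, h (f x) = h' (g x)) ->
  \big[op/idx]_(u in [set f x | x : T]) h u
    = \big[op/idx]_(v in [set g x | x : T]) h' v.
Proof.
(* The value of [pick] depends only on the extension of its predicate, so [D] is
   the same transversal for [f] and for [g]. *)
move=> fg hh'; pose D := [set x | [pick y | f y == f x] == Some x].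
have red (W : finType) (k : T -> W) (w : W -> R) :
    (forall x y, (f x == f y) = (k x == k y)) ->
  \big[op/idx]_(u in [set k x | x : T]) w u = \big[op/idx]_(x in D) w (k x).
  move=> fk; rewrite -(big_imset (h := k) w) /=.
    apply: eq_bigl => u; apply/imsetP/imsetP => -[x xD ->]; last by exists x.
    case e: [pick y | f y == f x] => [y|]; last first.
      by move: e; case: pickP => // /(_ x); rewrite eqxx.
    have fyx : f y == f x by move: e; case: pickP => // ? ? [<-].
    exists y; last by apply/esym/eqP; rewrite -fk.
    rewrite inE -e; apply/eqP/eq_pick => z /=; by rewrite (eqP fyx).
  move=> x y; rewrite !inE => /eqP ex /eqP ey /eqP; rewrite -fk => fxy.
  apply: Some_inj; rewrite -ex -ey; apply: eq_pick => z /=; by rewrite (eqP fxy).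
by rewrite (red _ f) // (red _ g) //; apply: eq_bigr => x _.
Qed.

End DistributeDependent.

Section Profile.
Local Open Scope ring_scope.

Lemma orbit_profileE (F : graph) (a : F) : connected F ->
  orbit_profile a = \sum_(O in root_orbits a) 'X^(orbit_dist a O).
Proof.
move=> cF; apply/polyP => k; rewrite coef_orbit_profile // coef_sum.
under eq_bigr do rewrite coefXn.
rewrite -sum1_card natr_sum big_mkcond [RHS]big_mkcond; apply: eq_bigr => O _.
case: ifP => [/imsetP[x]|nO].
  by rewrite inE => /eqP dx ->; rewrite imset_f // root_orbit_dist dx eqxx.
case: ifP => // /imsetP[x _ eO]; case: eqP => // ek.
by rewrite eO imset_f // inE ek eO root_orbit_dist in nO.
Qed.

Lemma horner1_profile (F : graph) (a : F) : connected F ->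
  (orbit_profile a).[1] = #|root_orbits a|%:R.
Proof.
move=> cF; rewrite orbit_profileE // horner_sum -sum1_card natr_sum.
by apply: eq_bigr => O _; rewrite hornerXn expr1n.
Qed.

End Profile.

(** Stars and bars, carried over from tuples along an enumeration of [T]. *)
Lemma card_ffun_sum (T : finType) (m : nat) : 0 < #|T| ->
  #|[set al : {ffun T -> 'I_m.+1} | \sum_O al O == m]| = 'C(#|T| + m - 1, m).
Proof.
case eT: #|T| => [//|n] _; rewrite addSn subn1 /= -bin_sub ?leq_addl // addnK.
rewrite -card_ord_partitions.
pose f (t : n.+1.-tuple 'I_m.+1) : {ffun T -> 'I_m.+1} :=
  [ffun O => tnth t (cast_ord eT (enum_rank O))].
pose g (al : {ffun T -> 'I_m.+1}) : n.+1.-tuple 'I_m.+1 :=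
  [tuple al (enum_val (cast_ord (esym eT) k)) | k < n.+1].
have fK : cancel f g.
  move=> t; apply: eq_from_tnth => k.
  by rewrite tnth_mktuple ffunE enum_valK cast_ordKV.
have gK : cancel g f.
  by move=> al; apply/ffunP => O; rewrite ffunE tnth_mktuple cast_ordK enum_rankK.
rewrite -(card_imset _ (can_inj fK)); congr #|pred_of_set _|; apply/setP => al.
rewrite -[al]gK (mem_imset _ _ (can_inj fK)) !inE gK; congr (_ == _).
rewrite big_tuple (reindex (fun O => cast_ord eT (enum_rank O))) /=.
  by apply: eq_bigr => O _; rewrite tnth_mktuple cast_ordK enum_rankK.
exists (fun k => enum_val (cast_ord (esym eT) k)) => k _.
  by rewrite cast_ordK enum_rankK.
by rewrite enum_valK cast_ordKV.
Qed.

(** * Invariant vectors *)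

Section Dimension.
Local Open Scope ring_scope.
Variables (R : realType) (F : graph) (a : F).

Lemma root_orbit_root : root_orbit a a = [set a].
Proof.
apply/setP => x; rewrite inE; apply/root_orbitP/eqP => [[p [_ pa <-//]]|->].
by exists 1%g; rewrite group1 perm1.
Qed.

Definition nonroot_orbit : finType :=
  {O : {set F} | (O \in root_orbits a) && (O != [set a])}.

Lemma nonroot_orbit_subproof (x : punctured a) :
  (root_orbit a (val x) \in root_orbits a) && (root_orbit a (val x) != [set a]).
Proof.
rewrite imset_f //=; apply: contraNneq (valP x) => e.
by rewrite -in_set1 -e root_orbit_refl.
Qed.

Definition nonroot_orbit_of (x : punctured a) : nonroot_orbit :=
  exist _ (root_orbit a (val x)) (nonroot_orbit_subproof x).

Lemma nonroot_orbit_of_surj O : exists x, nonroot_orbit_of x = O.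
Proof.
case: O => O /[dup] /andP[/imsetP[x _ ->] xa] ?.
have ax : x != a by apply: contraNneq xa => ->; rewrite root_orbit_root.
by exists (exist _ x ax); apply: val_inj.
Qed.

Lemma card_nonroot_orbit : (#|nonroot_orbit| + 1 = #|root_orbits a|)%N.
Proof.
rewrite card_sig (cardsD1 [set a]) -root_orbit_root imset_f // addnC; congr addn.
by apply: eq_card => O; rewrite !inE andbC.
Qed.

Definition orbit_pullback (w : {ffun nonroot_orbit -> R^o}) :
    {ffun punctured a -> R^o} :=
  [ffun x => w (nonroot_orbit_of x)].

Lemma orbit_pullback_linear : linear orbit_pullback.
Proof. by move=> k u v; apply/ffunP => x; rewrite !ffunE. Qed.

HB.instance Definition _ :=
  GRing.isLinear.Build R {ffun nonroot_orbit -> R^o} {ffun punctured a -> R^o} *:%R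
    orbit_pullback orbit_pullback_linear.

(** Vectors constant on orbits are the pullbacks of arbitrary functions on the
    set of orbits. *)
Lemma dim_invariant_space : (\dim (invariant_space R a) + 1 = #|root_orbits a|)%N.
Proof.
rewrite -card_nonroot_orbit; congr addn.
have -> : invariant_space R a = limg (linfun orbit_pullback).
  apply/vspaceP => u; apply/invariant_spaceP/memv_imgP => [inv|[w _ ->] x y yx].
    have [f fP] := fin_all_exists nonroot_orbit_of_surj.
    exists [ffun O => u (f O)]; first exact: memvf.
    apply/ffunP => x; rewrite lfunE /= !ffunE; apply: inv.
    by rewrite -root_orbit_eq; have /(congr1 val) /= -> := fP (nonroot_orbit_of x).
  rewrite lfunE /= !ffunE; congr (w _); apply: val_inj => /=.
  by apply/eqP; rewrite root_orbit_eq.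
rewrite limg_dim_eq ?dimvf /dim /= ?muln1 //.
apply/eqP; rewrite -subv0; apply/subvP => w; rewrite memv_cap memv_ker lfunE /=.
case/andP => _ /eqP w0; rewrite memv0; apply/eqP/ffunP => O; rewrite ffunE.
have [x <-] := nonroot_orbit_of_surj O.
by have := congr1 (fun u : {ffun punctured a -> R^o} => u x) w0; rewrite !ffunE.
Qed.

End Dimension.

(** * Products of powers *)

Section ProductOfPowers.
Variables (s : nat) (F : 'I_s -> graph) (m : 'I_s -> nat).
Let G := box_prod_pow F m.
Local Notation J := {i : 'I_s & 'I_(m i)}.
Local Notation H := (fun j : J => F (tag j)).
Local Notation slot := (Tagged (fun i => 'I_(m i))).

Definition entry (x : G) i (k : 'I_(m i)) : F i :=
  (x i : {ffun 'I_(m i) -> F i}) k.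

Definition of_entries (f : forall i, 'I_(m i) -> F i) : G :=
  @finfun _ (fun i => {ffun 'I_(m i) -> F i}) (fun i => [ffun k => f i k]).

Lemma of_entriesE f i k : entry (of_entries f) k = f i k.
Proof. by rewrite /entry ffunE ffunE. Qed.

Lemma entry_inj x y : (forall i (k : 'I_(m i)), entry x k = entry y k) -> x = y.
Proof. by move=> e; apply/ffunP => i; apply/ffunP => k; apply: e. Qed.

Lemma adj_entryP x y :
  reflect (exists2 j : J, adj (entry x (tagged j)) (entry y (tagged j)) &
             forall k : J, k != j -> entry x (tagged k) = entry y (tagged k))
          (adj x y).
Proof.
apply: (iffP existsP) => [[i /andP[/existsP[k /andP[xy /forallP ek]] /forallP ei]]|].
  exists (slot k) => // -[i' k'] /= nk.
  have [ii|ii] := eqVneq i' i; last first.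
    by rewrite /entry; have /implyP/(_ ii)/eqP -> := ei i'.
  move: k' nk; rewrite ii => k' nk; apply/eqP/(implyP (ek k')).
  by rewrite eq_Tagged in nk.
case=> -[i k] /= xy ek; exists i; apply/andP; split.
  apply/existsP; exists k; rewrite xy; apply/forallP => k'; apply/implyP => kk.
  by apply/eqP/(ek (slot k')); rewrite eq_Tagged.
apply/forallP => i'; apply/implyP => ii; apply/eqP/ffunP => k'.
by apply: (ek (slot k')); apply: contraNneq ii => /(congr1 tag) /= ->.
Qed.

(** The two nested products of [G] form one product over the pairs [(i, k)]. *)
Definition entry_coordinates : product_coordinates H G := ProductCoordinates
  (coord := fun x j => entry x (tagged j))
  (point := fun f => of_entries (fun i k => f (slot k)))
  (fun f j => match j with existT i k => of_entriesE _ k end)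
  (fun x y e => entry_inj (fun i k => e (slot k)))
  adj_entryP.

(** The automorphisms of this form suffice both to match vertices with equal
    counts and to prove vertex-transitivity. *)
Lemma aut_entries (t : forall i, 'S_(m i)) (g : forall i, 'I_(m i) -> {perm F i}) :
    (forall i k, g i k \in aut (F i)) ->
  exists2 p : {perm G}, p \in aut G &
    forall x i k, entry (p x) k = g i k (entry x (t i k)).
Proof.
move=> ag; pose p0 (x : G) := of_entries (fun i k => g i k (entry x (t i k))).
have p0_inj : injective p0.
  move=> x y e; apply: entry_inj => i k.
  have := congr1 (fun z => entry z ((t i)^-1%g k)) e.
  by rewrite !of_entriesE permKV => /perm_inj.
exists (perm p0_inj) => [|x i k]; last by rewrite permE of_entriesE.
(* The entry [j] of the image comes from the entry [pi j]. *)
pose pi (j : J) : J := slot (t (tag j) (tagged j)).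
have piK (j : J) : pi (slot ((t (tag j))^-1%g (tagged j))) = j.
  by case: j => i k; rewrite /pi /= permKV.
have pi_inj : injective pi.
  pose qi (j : J) : J := slot ((t (tag j))^-1%g (tagged j)).
  by apply: (@can_inj _ _ _ qi) => -[i k]; rewrite /pi /qi /= permK.
apply/autP => x y; rewrite !permE; apply/adj_entryP/adj_entryP => -[j].
  rewrite !of_entriesE (autP _ (ag _ _)) => xy ek; exists (pi j) => // l lj.
  rewrite -[l]piK in lj *; set l' := slot _ in lj *.
  have := ek l'; rewrite !of_entriesE => e; apply/perm_inj/e.
  by apply: contraNneq lj => ->.
rewrite -[j]piK; set j' := slot _ => xy ek; exists j' => [|k kj].
  by rewrite !of_entriesE (autP _ (ag _ _)).
rewrite !of_entriesE; congr (g _ _ _).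
by apply: (ek (pi k)); rewrite (inj_eq pi_inj).
Qed.

Lemma box_prod_pow_transitive :
    (forall i, vertex_transitive (F i)) ->
  forall b c : G, exists2 p, p \in aut G & p b = c.
Proof.
move=> F_tr b c.
have gP i : exists g : 'I_(m i) -> {perm F i}, forall k,
    g k \in aut (F i) /\ g k (entry b k) = entry c k.
  apply: (@fin_all_exists _ _ (fun k g =>
            g \in aut (F i) /\ g (entry b k) = entry c k)) => k.
  have /atransP2 tr := F_tr i.
  by have [p ap /= e] := tr _ _ (in_setT (entry b k)) (in_setT (entry c k)); exists p.
have [g {}gP] := fin_all_exists gP.
have [p ap pE] := aut_entries (fun i => 1%g) (fun i k => proj1 (gP i k)).
by exists p => //; apply: entry_inj => i k; rewrite pE perm1; case: (gP i k).
Qed.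

Section Rooted.
Hypotheses (F_conn : forall i, connected (F i))
  (F_prime : forall i, cartesian_prime (F i))
  (F_noniso : forall i j, i != j -> ~ isomorphic (F i) (F j)).
Variable r : forall i, F i.
Let a : G := diag_root m r.

Lemma entry_root i (k : 'I_(m i)) : entry a k = r i.
Proof. by rewrite /entry /a /diag_root ffunE ffunE. Qed.

Lemma product_connected : connected G.
Proof. exact: (coord_connected entry_coordinates (fun j => @F_conn (tag j))). Qed.

Local Notation count_families :=
  (fprod (fun i => {ffun root_orbit_type (r i) -> 'I_(m i).+1} : finType)).

Definition entry_counts (x : G) : count_families :=
  fprod_of_fun (fun i => orbit_count (r i) (fun k => entry x k)).

Lemma entry_countsE x i : entry_counts x i = orbit_count (r i) (fun k => entry x k).
Proof. by rewrite /entry_counts fprodE. Qed.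

Lemma dist_entry_counts x :
  dist a x = \sum_i \sum_O entry_counts x i O * orbit_dist (r i) (val O).
Proof.
rewrite (dist_coord entry_coordinates (fun j => @F_conn (tag j))) /=.
transitivity (\sum_(i < s) \sum_(k < m i) dist (entry a k) (entry x k)).
  by rewrite sig_big_dep.
apply: eq_bigr => i _.
rewrite entry_countsE (sum_orbit_count _ (fun O => orbit_dist (r i) (val O))).
by apply: eq_bigr => k _; rewrite root_orbit_dist entry_root.
Qed.

(** The orbit of the entry at index [j], tagged with its factor so that entries of
    different factors can be compared. *)
Definition entry_class (x : G) (j : J) : {i : 'I_s & {set F i}} :=
  Tagged (fun i => {set F i}) (root_orbit (r (tag j)) (entry x (tagged j))).

(** This is where pairwise non-isomorphism of the factors enters: an isomorphism
    between factors is an automorphism of a single one. *)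
Lemma class_iso i i' (f : F i -> F i') u :
    bijective f -> (forall v w, adj (f v) (f w) = adj v w) -> f (r i) = r i' ->
  Tagged (fun i => {set F i}) (root_orbit (r i) u)
    = Tagged (fun i => {set F i}) (root_orbit (r i') (f u)).
Proof.
have [ii|ii f_bij f_adj _] := eqVneq i i'; last first.
  by case: (F_noniso ii); exists f.
case: i' / ii f => f f_bij f_adj fr; congr Tagged.
apply/eqP; rewrite root_orbit_eq; apply/root_orbitP.
exists (perm (bij_inj f_bij)); rewrite !permE; split=> //.
by apply/autP => v w; rewrite !permE.
Qed.

Lemma card_entry_class x i (O : root_orbit_type (r i)) :
  #|[set j | entry_class x j == Tagged (fun i => {set F i}) (val O)]|
    = entry_counts x i O.
Proof.
rewrite entry_countsE orbit_countE.
have slot_inj : injective (fun k : 'I_(m i) => slot k).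
  by move=> k k' /eqP; rewrite eq_Tagged => /eqP.
rewrite -(card_imset _ slot_inj); congr #|pred_of_set _|; apply/setP => -[i' k].
rewrite inE; apply/eqP/imsetP => [e|[k' + ->]]; last first.
  by rewrite inE -val_eqE /= => /eqP e; rewrite /entry_class /= e.
have ii : i' = i by have /= := congr1 tag e.
move: k e; rewrite ii => k /eqP; rewrite eq_Tagged /= => e; exists k => //.
by rewrite inE -val_eqE.
Qed.

(** The forward direction rests on [aut_product]; in the other direction equal
    counts allow the copies of each factor to be permuted so that corresponding
    entries lie in the same root orbit. *)
Lemma root_orbit_entry_counts x y :
  (root_orbit a x == root_orbit a y) = (entry_counts x == entry_counts y).
Proof.
rewrite root_orbit_eq; apply/root_orbitP/eqP => [[p [ap pa <-]]|e].
  have [t tP] := @aut_product _ _ _ entry_coordinates (fun j => @F_conn (tag j))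
    (fun j => F_prime (tag j)) p a ap.
  have classP j : entry_class (p x) (t j) = entry_class x j.
    have [f [f_bij f_adj fE]] := tP j.
    rewrite /entry_class; have /= -> := fE x; symmetry; apply: class_iso => //.
    by have /= := fE a; rewrite pa !entry_root.
  apply/fprodP => i; apply/ffunP => O; apply: ord_inj.
  rewrite -!card_entry_class -(card_imset _ (@perm_inj _ t)).
  congr #|pred_of_set _|; apply/setP => j; rewrite -[j](permKV t).
  by rewrite mem_imset ?inE ?classP //; apply: perm_inj.
have /fin_all_exists[t tP] i : exists t : 'S_(m i), forall k,
    orbit_of (r i) (entry y k) = orbit_of (r i) (entry x (t k)).
  by apply: orbit_count_perm; rewrite -!entry_countsE e.
have gP i : exists g : 'I_(m i) -> {perm F i}, forall k,
    [/\ g k \in aut (F i), g k (r i) = r i & g k (entry x (t i k)) = entry y k].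
  apply: (@fin_all_exists _ _ (fun k g => [/\ g \in aut (F i), g (r i) = r i
            & g (entry x (t i k)) = entry y k])) => k.
  by apply/orbit_ofP; rewrite (tP i k).
have [g {}gP] := fin_all_exists gP.
have ag i k : g i k \in aut (F i) by case: (gP i k).
have [p ap pE] := aut_entries t ag.
exists p; split=> //; apply: entry_inj => i k; rewrite pE; last by case: (gP i k).
by rewrite !entry_root; case: (gP i k).
Qed.

Lemma entry_counts_image : [set entry_counts x | x : G]
  = [set al : count_families | [forall i, \sum_O al i O == m i]].
Proof.
apply/setP => al; rewrite inE; apply/imsetP/forallP => [[x _ ->] i|al_sum].
  by rewrite entry_countsE orbit_count_total.
have /fin_all_exists[u uP] i :
    exists u : 'I_(m i) -> F i, orbit_count (r i) u = al i.
  by apply: orbit_count_surj; apply/eqP/al_sum.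
exists (of_entries u) => //; apply/fprodP => i; rewrite entry_countsE -uP.
apply/ffunP => O; apply: ord_inj; rewrite !orbit_countE.
by congr #|pred_of_set _|; apply/setP => k; rewrite !inE of_entriesE.
Qed.

Lemma orbit_profile_product :
  orbit_profile a =
    (\prod_(i < s)
      \sum_(al : {ffun root_orbit_type (r i) -> 'I_(m i).+1}
              | (\sum_O al O)%N == m i)
        'X^(\sum_O al O * orbit_dist (r i) (val O)))%R.
Proof.
rewrite orbit_profileE; last exact: product_connected.
rewrite (@big_imset_kernel _ _ _ _ _ _ (root_orbit a) entry_counts _
  (fun al : count_families =>
     'X^(\sum_i \sum_O al i O * orbit_dist (r i) (val O)))%R); first last.
- by move=> x; rewrite root_orbit_dist dist_entry_counts.
- exact: root_orbit_entry_counts.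
under [RHS]eq_bigr do rewrite big_mkcond.
rewrite bigA_distr_fprod entry_counts_image [LHS]big_mkcond; apply: eq_bigr => al _.
rewrite inE; case: ifP => [/forallP al_sum|/negbT/forallPn[i /negbTE al_sum]].
  by rewrite expr_sum; apply: eq_bigr => i _; rewrite al_sum.
by rewrite (bigD1 i) //= al_sum mul0r.
Qed.

Lemma card_root_orbits_product :
  #|root_orbits a| = \prod_(i < s) 'C(#|root_orbits (r i)| + m i - 1, m i).
Proof.
apply/eqP; rewrite -(Num.Theory.eqr_nat int) -horner1_profile; last first.
  exact: product_connected.
rewrite orbit_profile_product horner_prod natr_prod; apply/eqP/eq_bigr => i _.
have -> : #|root_orbits (r i)| = #|root_orbit_type (r i)| by rewrite card_sig.
rewrite -card_ffun_sum; last by apply/card_gt0P; exists (orbit_of (r i) (r i)).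
rewrite horner_sum -sum1dep_card natr_sum; apply: eq_bigr => al _.
by rewrite hornerXn expr1n.
Qed.

End Rooted.
End ProductOfPowers.

Unset Implicit Arguments.
Local Open Scope ring_scope.

Theorem proposition7p1 (R : realType) (s : nat) (F : 'I_s -> graph)
    (m : 'I_s -> nat)
    (F_conn : forall i, connected (F i))
    (F_nontriv : forall i, nontrivial (F i))
    (F_vtrans : forall i, vertex_transitive (F i))
    (F_prime : forall i, cartesian_prime (F i))
    (F_noniso : forall i j, i != j -> ~ isomorphic (F i) (F j))
    (m_gt0 : forall i, (1 <= m i)%N) :
  let G := box_prod_pow F m in
  (forall r : (forall i, F i),
     let a : G := diag_root m r in
     let t i := #|root_orbits (r i)| in
     (\dim (invariant_space R a) + 1 = \prod_(i < s) 'C(t i + m i - 1, m i))%N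
     /\
     orbit_profile a =
       \prod_(i < s)
         \sum_(al : {ffun root_orbit_type (r i) -> 'I_(m i).+1}
                 | (\sum_O al O)%N == m i)
           'X^(\sum_O al O * orbit_dist (r i) (val O)))
  /\
  (forall b c : G,
     \dim (invariant_space R b) = \dim (invariant_space R c) /\
     orbit_profile b = orbit_profile c).
Proof.
move=> G; split=> [r a t|b c].
  by rewrite dim_invariant_space card_root_orbits_product // orbit_profile_product.
have [p ap <-] := box_prod_pow_transitive F_vtrans b c.
rewrite orbit_profile_aut //; split=> //; apply: (@addIn 1).
by rewrite !dim_invariant_space card_root_orbits_aut.
Qed.
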